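(* Let $R$ be a ring and $I$ an ideal of $R$ such that $R$ is a left DM ring for $I$. Then $R$ is an $I$-semiperfect ring if and only if ${}_RR$ is an $I$-supplemented module.
   Context: Rings are associative with identity; modules are unital left modules; ideals are two-sided; ''summand'' means direct summand. DM: a submodule $N\leq M$ is DM in $M$ if for every submodule $X$ of $M$ with $N+X=M$ there is a summand $S$ of $M$ with $S\leq N$ and $M=S+X$. A module $M$ is DM for $I$ if every submodule of $IM$ is DM in $M$. $R$ is a left DM ring for $I$ if every finitely generated free left $R$-module is DM for $I$. $I$-supplemented: a module $M$ is $I$-supplemented if for every submodule $X$ of $M$ there is a projective submodule $Y$ of $M$ such that $X+Y=M$, $X\cap Y\subseteq IY$ and $X\cap Y$ is DM in $Y$. $I$-semiperfect: a module $M$ is $I$-semiperfect if for every submodule $K$ of $M$ there is a decomposition $M=A\oplus B$ with $A$ projective, $A\subseteq K$ and $K\cap B\subseteq IM$. The ring $R$ is $I$-semiperfect if ${}_RR$ is an $I$-semiperfect module. *)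

(* Defs.v *)
From HB Require Import structures.
From mathcomp Require Import all_boot all_order all_algebra.
From mathcomp Require Import boolp classical_sets.

Set Implicit Arguments.
Unset Strict Implicit.
Unset Printing Implicit Defensive.

Import GRing.Theory.
Local Open Scope classical_set_scope.
Local Open Scope ring_scope.

(* Rings are [pzRingType], so the zero ring is allowed.  Subsets are
   Prop-valued ([set M]); membership [x \in A] is classical. *)

Definition two_sided_ideal (R : pzRingType) (I : set R) : Prop :=
  submod_closed (V := R^o) [in I] /\
  (forall x r : R, x \in I -> x * r \in I).

Record submodule (R : pzRingType) (M : lmodType R) := Submodule {
  submodule_set :> set M;
  submodule_closed : submod_closed [in submodule_set]
}.

Section SubmoduleType.
Variables (R : pzRingType) (M : lmodType R).

Definition submodule_type (Y : submodule M) : Type :=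
  {x : M | x \in submodule_set Y}.

HB.instance Definition _ (Y : submodule M) := SubChoice.on (submodule_type Y).
HB.instance Definition _ (Y : submodule M) :=
  GRing.SubChoice_isSubLmodule.Build R M [in submodule_set Y]
    (submodule_type Y) (submodule_closed Y).

Lemma submodule_within_closed (X Y : submodule M) :
  submod_closed [in [set y : submodule_type Y | \val y \in submodule_set X]].
Proof.
have [X0 XL] := submodule_closed X; split=> [|a u v].
  by rewrite inE.
by rewrite !inE; apply: XL.
Qed.

(* X `&` Y, as a submodule of the module Y. *)
Definition submodule_within (X Y : submodule M) :
  submodule (submodule_type Y) := Submodule (submodule_within_closed X Y).

End SubmoduleType.

Definition setadd (M : zmodType) (A B : set M) : set M :=
  [set a + b | a in A & b in B].

Section Modules.
Variable R : pzRingType.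
Implicit Types (M : lmodType R) (I : set R).

Definition projective (P : lmodType R) : Prop :=
  forall (A B : lmodType R) (g : {linear A -> B}) (f : {linear P -> B}),
    (forall b : B, exists a : A, g a = b) ->
    exists h : {linear P -> A}, forall x : P, g (h x) = f x.

Definition direct_decomposition M (A B : submodule M) : Prop :=
  setadd A B = setT /\ A `&` B = [set 0].

Definition summand M (S : submodule M) : Prop :=
  exists T : submodule M, direct_decomposition S T.

(* The product IA: finite sums of elements r *: a with r in I and a in A. *)
Definition ideal_mul I M (A : set M) : set M :=
  [set x | exists (n : nat) (r : 'I_n -> R) (a : 'I_n -> M),
     (forall k, r k \in I /\ a k \in A) /\ x = \sum_(k < n) r k *: a k].

Definition DM M (N : submodule M) : Prop :=
  forall X : submodule M, setadd N X = setT ->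
    exists S : submodule M, [/\ summand S, S `<=` N & setadd S X = setT].

Definition DM_for I M : Prop :=
  forall N : submodule M, N `<=` ideal_mul I [set: M] -> DM N.

Definition fg_free M : Prop :=
  exists (n : nat) (e : 'I_n -> M), forall x : M,
    exists! c : {ffun 'I_n -> R}, x = \sum_(k < n) c k *: e k.

Definition left_DM_ring_for I : Prop :=
  forall F : lmodType R, fg_free F -> DM_for I F.

Definition supplemented I M : Prop :=
  forall X : submodule M, exists Y : submodule M,
    [/\ projective (submodule_type Y),
        setadd X Y = setT,
        X `&` Y `<=` ideal_mul I Y
      & DM (submodule_within X Y)].

Definition semiperfect_module I M : Prop :=
  forall K : submodule M, exists A B : submodule M,
    [/\ direct_decomposition A B,
        projective (submodule_type A),
        A `<=` K
      & K `&` B `<=` ideal_mul I [set: M]].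

Definition semiperfect_ring I : Prop := semiperfect_module I R^o.

End Modules.

(* Main.v *)
(** If [M = A + B] is a decomposition with [A] inside [X] and the meet of [X]
    and [B] inside [IM], then [B] supplements [X]; the DM property passes to the
    summand [B] by the modular law.  Conversely, if [Y] supplements [K], lift
    the identity of the projective module [M] along [K * Y -> M]; the second
    component [f : M -> Y] is the identity modulo [K], so its image and the meet
    of [K] and [Y] span [Y].  The DM property gives [Y = S + T] with [S] inside
    [K] such that [f] followed by the projection to [T] is onto; the kernel and
    the image of a section of this map decompose [M] as required. *)

From HB Require Import structures.
Require Import Defs.
From mathcomp Require Import all_boot all_order all_algebra.
From mathcomp Require Import boolp classical_sets.

Set Implicit Arguments.
Unset Strict Implicit.
Unset Printing Implicit Defensive.

Import GRing.Theory.
Local Open Scope classical_set_scope.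
Local Open Scope ring_scope.

#[local] Identity Coercion set_pred : set >-> Funclass.

(** * Submodules, their sums and decompositions, elementwise *)

Section Submodules.
Variables (R : pzRingType) (M : lmodType R).
Implicit Types X Y : submodule M.

Lemma submodule0 X : X 0.
Proof. by have [/set_mem] := submodule_closed X. Qed.

Lemma submoduleZD X a u v : X u -> X v -> X (a *: u + v).
Proof.
have [_ XL] := submodule_closed X => /mem_set Xu /mem_set Xv.
exact/set_mem/XL.
Qed.

Lemma submoduleD X u v : X u -> X v -> X (u + v).
Proof. by move=> Xu Xv; rewrite -[u]scale1r; apply: submoduleZD. Qed.

Lemma submoduleN X u : X u -> X (- u).
Proof.
by move=> Xu; rewrite -[- u]addr0 -scaleN1r; apply: submoduleZD (submodule0 X).
Qed.

Lemma submoduleB X u v : X u -> X v -> X (u - v).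
Proof. by move=> Xu Xv; apply/submoduleD/submoduleN. Qed.

Lemma submodule_valP X (y : submodule_type X) : X (\val y).
Proof. exact/set_mem/(valP y). Qed.

Lemma submodule_valK X x : X x -> exists y : submodule_type X, \val y = x.
Proof. by move=> /mem_set Xx; exists (Sub x Xx); rewrite SubK. Qed.

Lemma setadd_submod_closed X Y : submod_closed [in setadd X Y].
Proof.
split=> [|a _ _ /set_mem[x1 X1 [y1 Y1 <-]] /set_mem[x2 X2 [y2 Y2 <-]]].
  apply/mem_set; exists 0; first exact: submodule0.
  by exists 0; [exact: submodule0|rewrite addr0].
apply/mem_set; exists (a *: x1 + x2); first exact: submoduleZD.
exists (a *: y1 + y2); first exact: submoduleZD.
by rewrite scalerDr addrACA.
Qed.

Definition submodule_add X Y := Submodule (setadd_submod_closed X Y).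

Lemma setaddP X Y : (forall z, exists2 x, X x & Y (z - x)) -> setadd X Y = setT.
Proof.
move=> XY; apply/seteqP; split=> // z _; have [x Xx Yzx] := XY z.
by exists x => //; exists (z - x) => //; rewrite addrC subrK.
Qed.

Lemma setaddT_sub X Y z : setadd X Y = setT -> exists2 x, X x & Y (z - x).
Proof.
move=> XY; have [x Xx [y Yy <-]] : setadd X Y z by rewrite XY.
by exists x => //; rewrite addrAC subrr add0r.
Qed.

Lemma direct_decompositionP X Y :
  (forall z, exists2 x, X x & Y (z - x)) ->
  (forall z, X z -> Y z -> z = 0) -> direct_decomposition X Y.
Proof.
move=> XY XY0; split; first exact: setaddP.
by apply/seteqP; split=> [z [] /XY0/[apply] //|_ ->]; split; apply: submodule0.
Qed.

Lemma direct_decomposition_eq0 X Y z :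
  direct_decomposition X Y -> X z -> Y z -> z = 0.
Proof. by move=> [_ XY0] Xz Yz; have : (X `&` Y) z by []; rewrite XY0. Qed.

Lemma direct_decomposition_sym X Y :
  direct_decomposition X Y -> direct_decomposition Y X.
Proof.
move=> XY; apply: direct_decompositionP => [z|z Yz Xz].
  have [x Xx Yzx] := setaddT_sub z XY.1.
  by exists (z - x); rewrite // subKr.
exact: direct_decomposition_eq0 XY Xz Yz.
Qed.

Lemma zero_submod_closed : submod_closed [in [set 0 : M]].
Proof.
split=> [|a u v /set_mem -> /set_mem ->]; apply: mem_set => //.
by rewrite /= scaler0 addr0.
Qed.

Lemma setT_submod_closed : submod_closed [in [set: M]].
Proof. by split=> [|a u v _ _]; exact: mem_set. Qed.

Lemma sub_ideal_mul (I : set R) (A B : set M) :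
  A `<=` B -> ideal_mul I A `<=` ideal_mul I B.
Proof.
move=> AB _ [n [r [a [ra ->]]]]; exists n, r, a; split=> // k.
by have [rk /set_mem/AB/mem_set ak] := ra k.
Qed.

End Submodules.

(** * Images and preimages under linear maps *)

Section LinearMaps.
Variables (R : pzRingType) (M N : lmodType R).
Variable f : {linear M -> N}.

Lemma image_submod_closed (X : submodule M) : submod_closed [in f @` X].
Proof.
split=> [|a _ _ /set_mem[x1 X1 <-] /set_mem[x2 X2 <-]].
  by apply/mem_set; exists 0; [exact: submodule0|rewrite linear0].
apply/mem_set; exists (a *: x1 + x2); first exact: submoduleZD.
by rewrite linearP.
Qed.

Definition submodule_image X := Submodule (image_submod_closed X).

Lemma preimage_submod_closed (Y : submodule N) : submod_closed [in f @^-1` Y].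
Proof.
split=> [|a u v /set_mem Yu /set_mem Yv]; apply: mem_set; rewrite /preimage /=.
  by rewrite linear0; exact: submodule0.
by rewrite linearP; exact: submoduleZD.
Qed.

Definition submodule_preimage Y := Submodule (preimage_submod_closed Y).

Lemma ideal_mul_linear (I : set R) (A : set M) x :
  ideal_mul I A x -> ideal_mul I (f @` A) (f x).
Proof.
move=> [n [r [a [ra ->]]]]; exists n, r, (f \o a); split=> [k|].
  have [rk /set_mem ak] := ra k; split=> //.
  by apply/mem_set; exists (a k).
by rewrite linear_sum; apply: eq_bigr => k _; rewrite linearZ.
Qed.

End LinearMaps.

(** * Retracts of modules *)

Section Retracts.
Variables (R : pzRingType) (M N : lmodType R).

Lemma projective_retract (i : {linear N -> M}) (p : {linear M -> N}) :
  cancel i p -> projective M -> projective N.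
Proof.
move=> ipK Mproj A B g f gsurj; have [h hP] := Mproj A B g (f \o p) gsurj.
by exists (h \o i) => x /=; rewrite hP /= ipK.
Qed.

(** Every [z] splits as [(z - i (p z)) + i (p z)]. The preimage of zero is the kernel of [p], and
    the image of the full submodule is the range of [i]. *)
Lemma retract_direct_decomposition (i : {linear N -> M}) (p : {linear M -> N}) :
  cancel i p ->
  direct_decomposition
    (submodule_preimage p (Submodule (@zero_submod_closed R N)))
    (submodule_image i (Submodule (@setT_submod_closed R N))).
Proof.
move=> ipK; apply: direct_decompositionP => [z|z].
  exists (z - i (p z)); first by rewrite /= /preimage /= linearB /= ipK subrr.
  by rewrite subKr /=; exists (p z).
rewrite /= /preimage /= => + [y _ yz].
by rewrite -yz ipK => ->; rewrite linear0.
Qed.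

End Retracts.

(** * Projections onto summands and properties inherited by summands *)

Section Decompositions.
Variables (R : pzRingType) (M : lmodType R).
Implicit Types (I : set R) (A B : submodule M).

Lemma direct_decomposition_proj A B : direct_decomposition A B ->
  exists p : {linear M -> submodule_type A},
    cancel \val p /\ (forall x, B (x - \val (p x))).
Proof.
move=> AB.
have /choice[p pP] : forall x, exists a : submodule_type A, B (x - \val a).
  move=> x; have [a Aa Bxa] := setaddT_sub x AB.1.
  by have [a' a'E] := submodule_valK Aa; exists a'; rewrite a'E.
(* Two candidates for the [A]-component of [x] differ by an element of both [A] and [B]. This
   uniqueness makes the chosen [p] linear and the identity on [A]. *)
have p_eq x a : B (x - \val a) -> p x = a.
  move=> Bxa; apply/val_inj/eqP; rewrite -subr_eq0; apply/eqP.
  apply: (direct_decomposition_eq0 AB).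
    by apply: submoduleB; apply: submodule_valP.
  have -> : \val (p x) - \val a = (x - \val a) - (x - \val (p x)).
    by rewrite opprB [RHS]addrC addrA subrK.
  exact: submoduleB.
have plin : linear p.
  move=> c u v; apply: p_eq; rewrite (linearP \val) /= opprD addrACA -scalerBr.
  exact: submoduleZD.
pose pL : {linear M -> submodule_type A} :=
  HB.pack p (GRing.isLinear.Build R M (submodule_type A) _ p plin).
exists pL; split=> [a|x]; last exact: pP.
by apply: p_eq; rewrite subrr; apply: submodule0.
Qed.

Lemma projective_summand A B :
  projective M -> direct_decomposition A B -> projective (submodule_type A).
Proof.
move=> Mproj /direct_decomposition_proj[p [pK _]].
exact: projective_retract pK Mproj.
Qed.

(** The projection onto [A] fixes [x], and it carries a sum of terms [r *: m] to a sum of terms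
    [r *: a] with [a] in [A]. *)
Lemma ideal_mul_summand I A B x : direct_decomposition A B ->
  A x -> ideal_mul I [set: M] x -> ideal_mul I A x.
Proof.
move=> /direct_decomposition_proj[p [pK _]] /submodule_valK[a <-] Ix.
rewrite -[X in ideal_mul I A (\val X)]pK.
apply: sub_ideal_mul (ideal_mul_linear (\val \o p) Ix) => _ [y _ <-].
exact: submodule_valP.
Qed.

(** Passes from the product formed inside [M] to the one formed in [A] as a module of its own, where
    [ideal_mul_linear] can be applied to maps out of [A]. *)
Lemma ideal_mul_submodule I A (a : submodule_type A) :
  ideal_mul I A (\val a) -> ideal_mul I [set: submodule_type A] a.
Proof.
move=> [n [r [b [rb aE]]]].
have /choice[c cE] k : exists c : submodule_type A, \val c = b k.
  by apply: submodule_valK; have [_ /set_mem] := rb k.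
exists n, r, c; split=> [k|].
  by split; [have [] := rb k|apply: mem_set].
apply: val_inj; rewrite aE linear_sum; apply: eq_bigr => k _.
by rewrite linearZ /= cE.
Qed.

Lemma DM_summand A B (N : submodule (submodule_type B)) :
  direct_decomposition A B -> DM (submodule_image \val N) -> DM N.
Proof.
move=> AB N_DM Z NZ.
(* Adding [A] to [Z] turns a sum equal to [B] into a sum equal to [M]. *)
have /N_DM[S [[T ST] SN SZA]] :
    setadd (submodule_image \val N)
           (submodule_add (submodule_image \val Z) A) = setT.
  apply: setaddP => x; have [a Aa /submodule_valK[b bE]] := setaddT_sub x AB.1.
  have [n Nn Zbn] := setaddT_sub b NZ.
  exists (\val n); first by exists n.
  exists (\val (b - n)); first by exists (b - n).
  by exists a => //; rewrite linearB /= bE addrAC subrK.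
have SB x : S x -> B x by move=> /SN[b _ <-]; apply: submodule_valP.
exists (submodule_within S B); split.
(* Modular law: since [S] lies in [B], the meet of [T] and [B] complements [S] in [B]. *)
- exists (submodule_within T B); apply: direct_decompositionP => [b|b].
    have [s Ss Tbs] := setaddT_sub (\val b) ST.1.
    have [s' s'E] := submodule_valK (SB _ Ss).
    by exists s'; apply/mem_set; rewrite ?linearB /= s'E.
  move=> /set_mem Sb /set_mem Tb; apply: val_inj.
  by rewrite linear0; apply: direct_decomposition_eq0 ST Sb Tb.
- by move=> b /set_mem/SN[n Nn /val_inj <-].
apply: setaddP => b.
have [s Ss [_ [z Zz <-] [a Aa zaE]]] := setaddT_sub (\val b) SZA.
have [s' s'E] := submodule_valK (SB _ Ss).
exists s'; first by apply/mem_set; rewrite s'E.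
(* The difference of the two sides equals [a], so it lies in [A] as well as in [B]. *)
suff -> : b - s' = z by [].
apply/val_inj/eqP; rewrite -subr_eq0; apply/eqP.
apply: direct_decomposition_eq0 AB _ _; last first.
  by rewrite -linearB; apply: submodule_valP.
by rewrite linearB /= s'E -zaE addrAC subrr add0r.
Qed.

End Decompositions.

(** * The two implications for a projective module *)

Section Supplements.
Variables (R : pzRingType) (M : lmodType R).
Implicit Types I : set R.

Lemma semiperfect_supplemented I : projective M -> DM_for I M ->
  semiperfect_module I M -> supplemented I M.
Proof.
move=> Mproj MDM Msp X; have [A [B [AB _ AX XB]]] := Msp X.
have BA := direct_decomposition_sym AB.
exists B; split; first exact: projective_summand Mproj BA.
- apply: setaddP => z; have [a /AX Xa Bza] := setaddT_sub z AB.1.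
  by exists a.
- by move=> x XBx; apply: ideal_mul_summand BA XBx.2 (XB _ XBx).
apply: DM_summand AB _; apply: MDM => _ [b /set_mem Xb <-].
by apply: XB; split=> //; apply: submodule_valP.
Qed.

Lemma supplemented_semiperfect I : projective M ->
  supplemented I M -> semiperfect_module I M.
Proof.
move=> Mproj Msup K; have [Y [Yproj KY KYI KY_DM]] := Msup K.
have [f fP] : exists f : {linear M -> submodule_type Y},
    forall m, K (m - \val (f m)).
  pose g : {linear (submodule_type K * submodule_type Y)%type -> M} :=
    (\val \o fst) \+ (\val \o snd).
  have [|h hP] := Mproj _ _ g idfun.
    move=> m; have [k Kk Yk] := setaddT_sub m KY.
    have [k' k'E] := submodule_valK Kk; have [y yE] := submodule_valK Yk.
    by exists (k', y); rewrite /= k'E yE addrC subrK.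
  exists (snd \o h) => m; rewrite -[X in X - _]hP /= addrK.
  exact: submodule_valP.
(* Membership in [K] can be tested after [f], as [m] and [f m] agree modulo [K]. *)
have Kf m : K m <-> K (\val (f m)).
  split=> Km; last by rewrite -[m](subrK (\val (f m))); apply: submoduleD.
  by rewrite -[\val _](subKr m); apply: submoduleB.
(* Each [y] in [Y] is [(y - f y) + f y], with first term in [K] and in [Y]. *)
have /KY_DM[S [[T ST] SK Sf]] : setadd (submodule_within K Y)
    (submodule_image f (Submodule (@setT_submod_closed R M))) = setT.
  apply: setaddP => y; exists (y - f (\val y)).
    by apply/mem_set; rewrite linearB; apply: fP.
  by rewrite subKr; exists (\val y).
have [p [pK pS]] := direct_decomposition_proj (direct_decomposition_sym ST).
have pS0 s : S s -> p s = 0.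
  move=> Ss; apply: val_inj; rewrite linear0.
  apply: direct_decomposition_eq0 ST _ (submodule_valP _).
  by rewrite -[\val _](subKr s); apply: submoduleB.
have Tproj := projective_summand Yproj (direct_decomposition_sym ST).
(* The projection [p] onto [T] kills [S], and [S] and the image of [f] span [Y]; so [p \o f] is onto
   the projective module [T] and has a section [h]. *)
have [|h hK] := Tproj _ _ (p \o f) idfun.
  move=> t; have [s Ss [m _ mE]] := setaddT_sub (\val t) Sf.
  by exists m; rewrite /= mE linearB /= pK pS0 // subr0.
have AB := retract_direct_decomposition hK.
eexists; eexists; split; first exact: AB.
- exact: projective_summand Mproj AB.
(* If [p (f m) = 0] then [f m] lies in [S], hence in [K], and so does [m]. *)
- move=> m; rewrite /= /preimage /= => pfm0; apply/Kf.
  apply/set_mem/SK; have := pS (f m).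
  by rewrite pfm0 (linear0 \val) subr0.
(* For [h t] in [K], the element [f (h t)] is in both [K] and [Y], hence in [IY]; applying [h \o p]
   gives back [h t], now seen to be in [IM]. *)
move=> _ [/[swap] -[t _ <-] /Kf Kt].
rewrite -[X in h X]hK.
apply: sub_ideal_mul (ideal_mul_linear (h \o p) _); first exact: subsetT.
by apply/ideal_mul_submodule/KYI; split=> //; apply: submodule_valP.
Qed.

End Supplements.

(** * The regular module is projective and free of rank one *)

Lemma projective_regular (R : pzRingType) : projective R^o.
Proof.
move=> A B g f gsurj; have [a aE] := gsurj (f 1).
(* A linear map out of [R^o] is determined by its value at 1, so it suffices to send 1 to a preimage
   of [f 1]. *)
pose h (x : R^o) : A := (x : R) *: a.
have hlin : linear h.
  by move=> c u v; rewrite /h scalerDl -scalerA.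
pose hL : {linear R^o -> A} :=
  HB.pack h (GRing.isLinear.Build R R^o A _ h hlin).
exists hL => x.
by rewrite /= linearZ /= aE -linearZ /= /GRing.scale /= mulr1.
Qed.

Lemma fg_free_regular (R : pzRingType) : fg_free R^o.
Proof.
exists 1%N, (fun=> 1) => x; exists [ffun=> x]; split=> [|c ->].
  by rewrite big_ord1 ffunE /GRing.scale /= mulr1.
by apply/ffunP => k; rewrite ffunE big_ord1 (ord1 k) /GRing.scale /= mulr1.
Qed.

Theorem corollary5p5 (R : pzRingType) (I : set R)
    (hI : two_sided_ideal I) (hDM : left_DM_ring_for I) :
  semiperfect_ring I <-> supplemented I (GRing.regular R).
Proof.
split; last exact/supplemented_semiperfect/projective_regular.
apply: semiperfect_supplemented; first exact: projective_regular.
exact/hDM/fg_free_regular.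
Qed.
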